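(* Let $X_1,X_2,\ldots$ be i.i.d. random variables with distribution function $F$, and let $x^F:=\sup\{x: F(x)<1\}$. Suppose $x^F$ exists finite. Let $U(t):=F^{\leftarrow}(1-1/t)$, $t>1$, be the tail quantile function, and assume that there are $\gamma\le 0$ and a positive measurable function $a(\cdot)$ such that $$\lim_{t\to\infty}\frac{U(tx)-U(t)}{a(t)}=\frac{x^{\gamma}-1}{\gamma}\qquad\text{for all } x>0$$ (the right-hand side being read as $\log x$ if $\gamma=0$). If $k=k_n$ is a sequence of positive integers with $k_n\to\infty$ and $k_n/n\to 0$ as $n\to\infty$, then the general endpoint estimator $$\hat{x}^F:=X_{n,n}+X_{n-k,n}-\frac{1}{\log 2}\sum_{i=0}^{k-1}\log\Bigl(1+\frac{1}{k+i}\Bigr)X_{n-k-i,n}$$ satisfies $\hat{x}^F\to x^F$ almost surely as $n\to\infty$; consequently $\hat{x}^F$ is a consistent estimator of $x^F<\infty$, i.e. $\hat x^F\to x^F$ in probability.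
   Context: $X_{1,n}\le X_{2,n}\le\cdots\le X_{n,n}$ denote the ascending order statistics of the sample $X_1,\ldots,X_n$. $F^{\leftarrow}$ denotes the generalized (left-continuous) inverse of $F$. The estimator $\hat x^F$ depends on $n$ and $k=k_n$ (it is defined for all $n$ large enough, since $k_n/n\to0$). *)

(* Defs.v *)
From HB Require Import structures.
From mathcomp Require Import all_boot all_order all_algebra.
From mathcomp Require Import all_classical all_reals all_analysis.

Set Implicit Arguments.
Unset Strict Implicit.
Unset Printing Implicit Defensive.

Import Order.TTheory GRing.Theory Num.Theory.
Import numFieldNormedType.Exports.

Local Open Scope classical_set_scope.
Local Open Scope ring_scope.

Section DistributionFunction.
Context {R : realType}.
Implicit Type F : R -> R.

Definition right_endpoint F : \bar R :=
  ereal_sup (EFin @` [set x | F x < 1]).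

(* For a distribution function F and 0 < y < 1 the set below is nonempty and
   bounded from below, so that [inf] is its greatest lower bound; outside this
   range of y the value is irrelevant. *)
Definition gen_inverse F (y : R) : R := inf [set x | y <= F x].

Definition tail_quantile F (t : R) : R := gen_inverse F (1 - t^-1).

Definition ev_limit (gamma x : R) : R :=
  if gamma == 0 then ln x else (x `^ gamma - 1) / gamma.

Definition extreme_value_condition (U a : R -> R) (gamma : R) : Prop :=
  forall x : R, 0 < x ->
    (U (t * x) - U t) / a t @[t --> +oo] --> ev_limit gamma x.

End DistributionFunction.

Section RandomSequence.
Context {d : measure_display} {T : measurableType d} {R : realType}.

Definition mutually_independent (P : probability T R)
    (X : nat -> {RV P >-> R}) : Prop :=
  forall (s : seq nat) (B : nat -> set R), uniq s ->
    (forall i, measurable (B i)) ->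
    P (\bigcap_(i in [set` s]) (X i @^-1` B i)) =
      (\prod_(i <- s) P (X i @^-1` B i))%E.

Definition cvg_in_probability (P : probability T R)
    (Y : nat -> T -> R) (c : R) : Prop :=
  forall eps : R, 0 < eps ->
    P [set w | eps < `|Y n w - c|] @[n --> \oo] --> 0%E.

(* The j-th smallest of the n first values x 0, ..., x n.-1, where j runs from
   1 to n; it is a junk value when j is not in this range. *)
Definition order_stat (x : nat -> R) (j n : nat) : R :=
  nth 0 (sort <=%R [seq x i | i <- iota 0 n]) j.-1.

(* All the ranks below lie in {1, ..., n} as soon as 2 * k <= n. *)
Definition endpoint_estimator (x : nat -> R) (k n : nat) : R :=
  order_stat x n n + order_stat x (n - k) n -
  (ln 2)^-1 * \sum_(i < k) ln (1 + (k + i)%N%:R^-1) * order_stat x (n - k - i) n.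

End RandomSequence.

(* Main.v *)
Require Import Defs.
From HB Require Import structures.
From mathcomp Require Import all_boot all_order all_algebra.
From mathcomp Require Import all_classical all_reals all_analysis.
From mathcomp Require Import measurable_realfun.
From mathcomp Require Import lra zify.

Set Implicit Arguments.
Unset Strict Implicit.
Unset Printing Implicit Defensive.

Import Order.TTheory GRing.Theory Num.Theory.
Import numFieldNormedType.Exports.

Local Open Scope classical_set_scope.
Local Open Scope ring_scope.

(** The weights [ln (1 + 1 / (k + i))], [i < k], telescope to [ln 2], so that
    the estimator minus [xF] is
      (X_{n,n} - xF) + (X_{n-k,n} - xF)
    minus a convex combination of the differences [X_{n-k-i,n} - xF].  All
    these order statistics are among the [2 k] largest ones.  If no observation
    exceeds [xF + e] and at least [2 k] of the first [n] exceed [xF - e], each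
    of the differences is at most [e] in absolute value, and the error of the
    estimator is at most [3 e] (endpoint_estimator_dist).

    The first condition holds almost surely for all indices at once, because
    [F] is 1 above its right endpoint.  For the second one, an observation
    exceeds [xF - e] with a fixed positive probability, while [2 k] is
    negligible with respect to [n]: an exponential Markov bound for the number
    of exceedances (prob_few_exceedances) dominates the probability of having
    fewer than [2 k] of them by a geometric sequence
    (exp_growth_le_geometric).  The Borel-Cantelli lemma then gives almost sure
    convergence.  The same geometric bound gives convergence in probability
    directly, once the estimator is known to be measurable. *)

(** * Order statistics and exceedances *)

Section OrderStatistics.
Context {R : realType}.
Implicit Types (x : nat -> R) (t c e : R).

Definition exceedances x t n : {set 'I_n} := [set i : 'I_n | t < x i]%SET.

Lemma card_exceedances_le x t n : (#|exceedances x t n| <= n)%N.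
Proof. by rewrite -[leqRHS]card_ord max_card. Qed.

Lemma count_sample_gt x t n :
  count (> t) [seq x i | i <- iota 0 n] = #|exceedances x t n|.
Proof.
rewrite cardsE cardE count_map -val_enum_ord count_map -size_filter.
by rewrite enumT; congr size; apply: eq_filter => i /=.
Qed.

Lemma count_sample_le x t n :
  count (<= t) [seq x i | i <- iota 0 n] = (n - #|exceedances x t n|)%N.
Proof.
have := count_predC (> t) [seq x i | i <- iota 0 n].
rewrite size_map size_iota count_sample_gt.
have /eq_count -> : predC (> t) =1 (<= t) by move=> y /=; rewrite leNgt.
lia.
Qed.

(** This equivalence reduces every question about order statistics, be it a
    bound or measurability, to counting exceedances. *)
Lemma order_stat_gt x t j n : (0 < j <= n)%N ->
  (t < order_stat x j n) = (n - j < #|exceedances x t n|)%N.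
Proof.
move=> /andP[j0 jn]; pose s := sort <=%R [seq x i | i <- iota 0 n].
have s_sorted : sorted <=%O s by exact: sort_le_sorted.
have s_size : size s = n by rewrite size_sort size_map size_iota.
have s_count : count (<= t) s = (n - #|exceedances x t n|)%N.
  by rewrite count_sort count_sample_le.
have en := card_exceedances_le x t n.
rewrite /order_stat -/s; apply/idP/idP => [|H].
  apply: contraTT; rewrite -leqNgt -leNgt => H.
  by apply: nth_count_le => //; rewrite s_count; lia.
by apply: nth_count_gt => //; rewrite s_count s_size; lia.
Qed.

(** The [i]-th weight is [ln (k + i + 1) - ln (k + i)], so that the sum
    telescopes to [ln (2 k) - ln k]. *)
Lemma sum_log_weights k : (0 < k)%N ->
  \sum_(i < k) ln (1 + (k + i)%N%:R^-1) = ln 2 :> R.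
Proof.
move=> k0.
have weightE i : ln (1 + (k + i)%N%:R^-1) =
    ln (k + i.+1)%N%:R - ln (k + i)%N%:R :> R.
  have ki0 : 0 < (k + i)%N%:R :> R by rewrite ltr0n addn_gt0 k0.
  rewrite addnS -ln_div ?posrE ?ltr0Sn//; congr ln.
  by rewrite -natr1 mulrDl mul1r divff ?gt_eqF.
under eq_bigr do rewrite weightE.
rewrite -(big_mkord xpredT (fun i => ln (k + i.+1)%N%:R - ln (k + i)%N%:R)).
rewrite (telescope_sumr (fun i => ln (k + i)%N%:R : R))// addn0.
rewrite -ln_div ?posrE ?ltr0n ?addn_gt0 ?k0//; congr ln.
have k1 : k%:R != 0 :> R by rewrite pnatr_eq0 -lt0n.
by rewrite addnn -muln2 natrM mulrAC divff// mul1r.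
Qed.

(** The hypotheses place the [2 k] largest order statistics within [e] of [c].
    The estimator is the sum of two of them minus a weighted average of them,
    whence three errors of size at most [e]. *)
Lemma endpoint_estimator_dist x c e k n : (0 < k)%N ->
  (forall i, x i <= c + e) -> (2 * k <= #|exceedances x (c - e) n|)%N ->
  `|endpoint_estimator x k n - c| <= 3 * e.
Proof.
move=> k0 x_le many.
have en := card_exceedances_le x (c - e) n.
have near m : (m < 2 * k)%N -> `|order_stat x (n - m) n - c| <= e.
  move=> mk; have nm : (0 < n - m <= n)%N by lia.
  have no_exc : #|exceedances x (c + e) n| = 0%N.
    apply/eqP; rewrite cards_eq0; apply/eqP/setP => i.
    by rewrite !inE ltNge x_le.
  have lo : c - e < order_stat x (n - m) n by rewrite order_stat_gt//; lia.
  have hi : order_stat x (n - m) n <= c + e.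
    by rewrite leNgt order_stat_gt// no_exc.
  by rewrite ler_norml; apply/andP; split; lra.
have ln2 : 0 < ln 2 :> R by rewrite ln_gt0// ltr1n.
pose w i : R := ln (1 + (k + i)%N%:R^-1).
have w_ge0 i : 0 <= w i by rewrite ln_ge0// lerDl invr_ge0.
have sum_w : \sum_(i < k) w i = ln 2 by exact: sum_log_weights.
have avgE : (ln 2)^-1 * \sum_(i < k) w i * order_stat x (n - k - i) n - c =
    (ln 2)^-1 * \sum_(i < k) w i * (order_stat x (n - k - i) n - c).
  under [in RHS]eq_bigr do rewrite mulrBr.
  rewrite sumrB -mulr_suml sum_w mulrBr; congr (_ - _).
  by rewrite mulrA mulVf ?mul1r// gt_eqF.
have avg_le : `|(ln 2)^-1 * \sum_(i < k) w i * order_stat x (n - k - i) n - c|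
    <= e.
  rewrite avgE normrM gtr0_norm ?invr_gt0// mulrC ler_pdivrMr//.
  rewrite -sum_w mulr_sumr; apply: le_trans (ler_norm_sum _ _ _) _.
  apply: ler_sum => i _; rewrite normrM (ger0_norm (w_ge0 _)) mulrC.
  by rewrite ler_wpM2r// -subnDA near//; have := ltn_ord i; lia.
have top : `|order_stat x n n - c| <= e.
  by have := near 0%N; rewrite subn0; apply; lia.
have kth : `|order_stat x (n - k) n - c| <= e by apply: near; lia.
rewrite /endpoint_estimator -/(w _).
move: avg_le top kth; rewrite !ler_norml.
move=> /andP[? ?] /andP[? ?] /andP[? ?]; apply/andP; split; lra.
Qed.

End OrderStatistics.

(** * Probability of having few exceedances *)

Section ExceedanceProbability.
Context {d : measure_display} {T : measurableType d} {R : realType}.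
Context (P : probability T R) (X : nat -> {RV P >-> R}).
Implicit Types (t : R) (m n : nat).

(** These events, for [S] ranging over the subsets of ['I_n], form a finite
    partition of the sample space into rectangles, on which independence gives
    the exact probabilities. *)
Definition exceedance_event t n (S : {set 'I_n}) : set T :=
  [set w | exceedances (X^~ w) t n = S].

Definition few_exceedances t n m : set T :=
  [set w | (#|exceedances (X^~ w) t n| < m)%N].

Lemma exceedance_eventE t n (S : {set 'I_n}) :
  exceedance_event t S =
  \bigcap_(i in [set` iota 0 n])
    X i @^-1` [set y | (t < y) = (i \in [seq val j | j <- enum S])].
Proof.
have memS (j : 'I_n) : (val j \in [seq val j | j <- enum S]) = (j \in S).
  by rewrite mem_map ?mem_enum//; exact: val_inj.
apply/seteqP; split => w /= Sw.
  move=> i /=; rewrite mem_iota => /= i_n.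
  by rewrite -[i]/(val (Ordinal i_n)) memS -Sw inE.
apply/setP => j; rewrite inE -memS; apply: Sw => /=.
by rewrite mem_iota /=.
Qed.

Lemma gt_setE (t : R) (b : bool) :
  [set y | (t < y) = b] = [set` if b then `]t, +oo[ else `]-oo, t]] :> set R.
Proof.
case: b; apply/seteqP; split => y /=; rewrite in_itv/= ?andbT ?leNgt//.
  by move=> ->.
by move=> /negbTE.
Qed.

Lemma measurable_gt_set (t : R) (b : bool) :
  measurable [set y : R | (t < y) = b].
Proof. by rewrite gt_setE; case: b; exact: measurable_itv. Qed.

Lemma measurable_exceedance_event t n (S : {set 'I_n}) :
  measurable (exceedance_event t S).
Proof.
rewrite exceedance_eventE; apply: fin_bigcap_measurable => [|i _].
  exact: finite_seq.
by apply: measurable_funPTI; exact: measurable_gt_set.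
Qed.

Lemma few_exceedancesE t n m : few_exceedances t n m =
  \big[setU/set0]_(S : {set 'I_n} | (#|S| < m)%N) exceedance_event t S.
Proof.
transitivity (\bigcup_(S in [set` [pred S : {set 'I_n} | (#|S| < m)%N]])
    exceedance_event t S); last by rewrite bigcup_pred.
apply/seteqP; split => w /=.
  by exists (exceedances (X^~ w) t n).
by move=> [S /= Sm wS]; rewrite /few_exceedances /= wS.
Qed.

Lemma measurable_few_exceedances t n m : measurable (few_exceedances t n m).
Proof.
rewrite few_exceedancesE; apply: bigsetU_measurable => S _.
exact: measurable_exceedance_event.
Qed.

Lemma measurable_order_stat j n : (0 < j <= n)%N ->
  measurable_fun setT (fun w => order_stat (X^~ w) j n).
Proof.
move=> jn; apply: (measurability _ (RGenOInfty.measurableE R)) => //.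
move=> _ [_ [t ->] <-]; rewrite setTI.
rewrite (_ : _ @^-1` _ = ~` few_exceedances t n (n - j).+1).
  by apply: measurableC; exact: measurable_few_exceedances.
apply/seteqP; split => w;
  rewrite /few_exceedances /= in_itv/= andbT order_stat_gt// ltnS ltnNge.
  by move=> /negP.
by move=> /negP.
Qed.

Lemma measurable_endpoint_estimator k n : (0 < k)%N -> (2 * k <= n)%N ->
  measurable_fun setT (fun w => endpoint_estimator (X^~ w) k n).
Proof.
move=> k0 kn; apply: measurable_funB.
  by apply: measurable_funD; apply: measurable_order_stat; lia.
apply: measurable_funM => //; apply: measurable_sum => i.
apply: measurable_funM => //; apply: measurable_order_stat.
by have := ltn_ord i; lia.
Qed.

Context (F : R -> R) (X_indep : mutually_independent X)
  (X_cdf : forall (i : nat) (x : R), cdf (X i) x = (F x)%:E).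

Lemma prob_gt i t : P (X i @^-1` `]t, +oo[) = (1 - F t)%:E.
Proof. by have := ccdf_1_cdf (X i) t; rewrite X_cdf. Qed.

Lemma cdf_bounds t : 0 <= F t <= 1.
Proof.
have := cdf_ge0 (X 0) t; have := cdf_le1 (X 0) t.
by rewrite X_cdf !lee_fin => -> ->.
Qed.

Lemma prob_exceedance_event t n (S : {set 'I_n}) :
  P (exceedance_event t S) =
  (\prod_(i < n) (if i \in S then 1 - F t else F t))%:E.
Proof.
rewrite exceedance_eventE X_indep ?iota_uniq//; last first.
  by move=> i; exact: measurable_gt_set.
rewrite -val_enum_ord big_map big_enum -prodEFin; apply: eq_bigr => i _.
rewrite gt_setE mem_map ?mem_enum; last exact: val_inj.
by case: ifP => _; [exact: prob_gt|exact: X_cdf].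
Qed.

(** This is the exponential Markov inequality with base [1/2] for the number [N]
    of exceedances: [P (N < m) <= 2 ^ m * E (2 ^ - N)], where [2 ^ - N] is a
    product of [n] independent factors of mean
    [(1 - F t) / 2 + F t = (1 + F t) / 2].
    No expectation is formed: the event is a union of rectangles
    [exceedance_event t S], and expanding the [n]-th power of the mean over the
    subsets [S] gives their probabilities weighted by [2 ^ - #|S|]. *)
Lemma prob_few_exceedances t n m :
  (P (few_exceedances t n m) <= (2 ^+ m * ((1 + F t) / 2) ^+ n)%:E)%E.
Proof.
have /andP[F0 F1] := cdf_bounds t.
have Boole : (P (few_exceedances t n m) <=
    \sum_(S : {set 'I_n} | (#|S| < m)%N) P (exceedance_event t S))%E.
  rewrite few_exceedancesE.
  pose K (A : set T) (u : \bar R) := measurable A /\ (P A <= u)%E.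
  suff : K (\big[setU/set0]_(S : {set 'I_n} | (#|S| < m)%N) exceedance_event t S)
      (\sum_(S : {set 'I_n} | (#|S| < m)%N) P (exceedance_event t S))%E by case.
  apply: (big_ind2 K); first by split; rewrite ?measure0.
    move=> A u B v [mA Au] [mB Bv]; split; first exact: measurableU.
    by apply: le_trans (leeD Au Bv); exact: measureU2.
  by move=> S _; split => //; exact: measurable_exceedance_event.
apply: le_trans Boole _.
under eq_bigr do rewrite prob_exceedance_event.
rewrite sumEFin lee_fin.
have -> : ((1 + F t) / 2) ^+ n =
    \sum_(S : {set 'I_n}) \prod_(i < n) (if i \in S then (1 - F t) / 2 else F t).
  rewrite -(bigA_distr 1 +%R) prodr_const card_ord; congr (_ ^+ _) => /=; lra.
rewrite mulr_sumr [leRHS](bigID (fun S : {set 'I_n} => #|S| < m)%N)/=.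
rewrite -[leLHS]addr0; apply: lerD; last first.
  apply: sumr_ge0 => S _; rewrite mulr_ge0 ?exprn_ge0//.
  by apply: prodr_ge0 => i _; case: ifP => _ //; lra.
apply: ler_sum => S Sm.
(* The factors 1/2 attached to S amount to 2 ^ - #|S|, which is at least
   2 ^ - m. *)
have prod_split (p : R) : \prod_(i < n) (if i \in S then p else F t) =
    p ^+ #|S| * \prod_(i < n | i \notin S) F t.
  rewrite (bigID (mem S))/= -prodr_const; congr (_ * _).
    by apply: eq_bigr => i ->.
  by apply: eq_bigr => i /negPf ->.
rewrite !prod_split mulrA ler_wpM2r//; first exact: prodr_ge0.
rewrite -{1}(subnK (ltnW Sm)) exprD expr_div_n -mulrA.
rewrite [2 ^+ #|S| * _]mulrC divfK; last by rewrite expf_neq0.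
by rewrite ler_peMl ?exprn_ge0 ?subr_ge0// exprn_ege1// ler1n.
Qed.

End ExceedanceProbability.

(** * Geometric bounds and the Borel-Cantelli lemma *)

Section BorelCantelliGeometric.
Context {d : measure_display} {T : measurableType d} {R : realType}.
Context (mu : {measure set T -> \bar R}).

Lemma ae_eventually_not (A : nat -> set T) (r : R) :
  0 <= r < 1 -> (forall n, measurable (A n)) ->
  (\forall n \near \oo, (mu (A n) <= (r ^+ n)%:E)%E) ->
  {ae mu, forall w, \forall n \near \oo, ~ A n w}.
Proof.
move=> /andP[r0 r1] mA [N _ small].
(* The bound only holds from rank N on; dropping finitely many events does not
   change their upper limit. *)
pose B n := A (N + n)%N.
have sum_fin : (\sum_(n <oo) mu (B n) < +oo)%E.
  apply: (@le_lt_trans _ _ (\sum_(n <oo) (r ^+ n)%:E)%E).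
    apply: lee_nneseries => // n _; apply: le_trans (small _ (leq_addr _ _)) _.
    by rewrite lee_fin exprD ler_piMl ?exprn_ge0// exprn_ile1// ltW.
  apply: (@le_lt_trans _ _ ((1 - r)^-1)%:E); last by rewrite ltry.
  apply: lime_le.
    by apply: is_cvg_nneseries => n _ _; rewrite lee_fin exprn_ge0.
  apply: nearW => n; rewrite sumEFin lee_fin.
  have -> : \sum_(0 <= i < n) r ^+ i = series (geometric 1 r) n.
    by rewrite exprn_geometric.
  rewrite geometric_seriesE ?lt_eqF// /= mul1r.
  by rewrite ler_pdivrMr ?subr_gt0// mulVf ?subr_eq0 ?gt_eqF// gerBl exprn_ge0.
have mB n : measurable (B n) by exact: mA.
exists (lim_sup_set B); split.
- by apply: bigcap_measurable => // n _; apply: bigcup_measurable.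
- exact: lim_sup_set_cvg0.
- move=> w /= inf_often n _; apply: contrapT => Bn; apply: inf_often.
  exists (N + n)%N => // m /= Nm Am; apply: Bn; exists (m - N)%N => /=.
    by lia.
  by rewrite /B subnKC//; lia.
Qed.

End BorelCantelliGeometric.

(** One factor [sqrt q ^ n] of [q ^ n] serves as the bound.  The other one
    absorbs [2 ^ (2 k n)], since [sqrt q ^ M <= 1/2] for some [M], and
    eventually [M * (2 k n) <= n]. *)
Lemma exp_growth_le_geometric (R : realType) (q : R) (k : nat -> nat) :
  0 <= q < 1 -> (k n)%:R / n%:R @[n --> \oo] --> (0 : R) ->
  exists2 r : R, 0 <= r < 1 &
    \forall n \near \oo, (2 * k n <= n)%N /\ 2 ^+ (2 * k n) * q ^+ n <= r ^+ n.
Proof.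
move=> /andP[q0 q1] k_over_n; pose r := Num.sqrt q.
have r0 : 0 <= r by exact: sqrtr_ge0.
have r1 : r < 1 by rewrite -[ltRHS]sqrtr1 ltr_sqrt.
have rr : r ^+ 2 = q by exact: sqr_sqrtr.
exists r; first by rewrite r0.
have [M M0 rM] : exists2 M, (0 < M)%N & 2 * r ^+ M <= 1.
  have /cvgr_lt/(_ (2^-1)) : r ^+ n @[n --> \oo] --> (0 : R).
    by apply: cvg_expr; rewrite ger0_norm.
  rewrite invr_gt0 ltr0n => /(_ isT)[M _ rM]; exists M.+1 => //.
  have := rM M.+1 (leqnSn M); rewrite /= => rM1; lra.
have M0' : 0 < M%:R :> R by rewrite ltr0n.
have /cvgr_lt/(_ ((2 * M%:R)^-1)) := k_over_n.
rewrite invr_gt0 mulr_gt0// => /(_ isT) small.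
near=> n.
have n0 : (0 < n)%N by near: n; exists 1%N.
have kMn : (M * (2 * k n) <= n)%N.
  have : (k n)%:R / n%:R < (2 * M%:R)^-1 :> R by near: n.
  rewrite ltr_pdivrMr ?ltr0n// mulrC ltr_pdivlMr ?mulr_gt0// => /ltW.
  by rewrite -!natrM ler_nat; lia.
split; first by nia.
rewrite -rr exprAC expr2 mulrA ler_piMl ?exprn_ge0//.
apply: (@le_trans _ _ (2 ^+ (2 * k n) * r ^+ (M * (2 * k n)))).
  by rewrite ler_wpM2l ?exprn_ge0// ler_wiXn2l// ltW.
by rewrite [r ^+ _]exprM -exprMn exprn_ile1// mulr_ge0// exprn_ge0.
Unshelve. all: by end_near. Qed.

(** * The right endpoint of the distribution *)

Section Endpoint.
Context {d : measure_display} {T : measurableType d} {R : realType}.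
Context (P : probability T R) (X : nat -> {RV P >-> R}) (F : R -> R) (xF : R).
Context (X_cdf : forall (i : nat) (x : R), cdf (X i) x = (F x)%:E).
Context (F_endpoint : right_endpoint F = xF%:E).

Lemma cdf_below_endpoint e : 0 < e -> F (xF - e) < 1.
Proof.
move=> e0.
have [_ [y Fy <-]] : exists2 y : \bar R, [set z%:E | z in [set x | F x < 1]] y &
    ((xF - e)%:E < y)%E.
  by apply: ereal_sup_gt; rewrite -/(right_endpoint F) F_endpoint lte_fin; lra.
rewrite lte_fin => /ltW le_y; apply: le_lt_trans Fy.
by have := cdf_nondecreasing (X 0) le_y; rewrite !X_cdf lee_fin.
Qed.

Lemma cdf_above_endpoint e : 0 < e -> F (xF + e) = 1.
Proof.
move=> e0; apply/eqP; rewrite eq_le.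
have /andP[_ ->] := cdf_bounds X_cdf (xF + e).
rewrite leNgt; apply/negP => F1.
have : ((xF + e)%:E <= right_endpoint F)%E.
  by apply: ereal_sup_ubound; exists (xF + e).
by rewrite F_endpoint lee_fin; lra.
Qed.

Lemma ae_le_endpoint e : 0 < e -> {ae P, forall w, forall i, X i w <= xF + e}.
Proof.
move=> e0; apply: ae_foralln => i.
exists (X i @^-1` `]xF + e, +oo[); split.
- by apply: measurable_funPTI; exact: measurable_itv.
- by apply: etrans (prob_gt X_cdf i _) _; rewrite cdf_above_endpoint// subrr.
- by move=> w /= /negP; rewrite -ltNge in_itv/= andbT.
Qed.

End Endpoint.

(** * Consistency of the endpoint estimator *)

Theorem proposition1 (d : measure_display) (T : measurableType d)
    (R : realType) (P : probability T R) (X : nat -> {RV P >-> R})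
    (F : R -> R) (xF : R) (gamma : R) (a : R -> R) (k : nat -> nat)
    (X_indep : mutually_independent X)
    (X_cdf : forall (i : nat) (x : R), cdf (X i) x = (F x)%:E)
    (F_endpoint : right_endpoint F = xF%:E)
    (gamma_le0 : gamma <= 0)
    (a_gt0 : forall t : R, 1 < t -> 0 < a t)
    (a_meas : measurable_fun (`]1, +oo[ : set R) a)
    (F_ev : extreme_value_condition (tail_quantile F) a gamma)
    (k_gt0 : forall n : nat, (0 < n)%N -> (0 < k n)%N)
    (k_infty : k @ \oo --> \oo)
    (k_over_n : (k n)%:R / n%:R @[n --> \oo] --> (0 : R)) :
  let estimator (n : nat) (w : T) :=
    endpoint_estimator (fun i => X i w) (k n) n in
  {ae P, forall w, estimator n w @[n --> \oo] --> xF} /\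
  cvg_in_probability P estimator xF.
Proof.
move=> estimator.
pose bad e n := few_exceedances X (xF - e) n (2 * k n).
have bad_small e : 0 < e -> exists2 r : R, 0 <= r < 1 &
    \forall n \near \oo, (2 * k n <= n)%N /\ (P (bad e n) <= (r ^+ n)%:E)%E.
  move=> e0; have F1 := cdf_below_endpoint X_cdf F_endpoint e0.
  have /andP[F0 _] := cdf_bounds X_cdf (xF - e).
  have q01 : 0 <= (1 + F (xF - e)) / 2 < 1 by apply/andP; split; lra.
  have [r r01 r_bound] := exp_growth_le_geometric q01 k_over_n.
  exists r => //; apply: filterS r_bound => n [kn rn]; split=> //.
  apply: le_trans (prob_few_exceedances X_indep X_cdf _ _ _) _.
  by rewrite lee_fin.
have estimator_near e n w : (0 < n)%N -> (forall i, X i w <= xF + e) ->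
    ~ bad e n w -> `|estimator n w - xF| <= 3 * e.
  move=> n0 le_xF /negP; rewrite -leqNgt => many.
  by apply: endpoint_estimator_dist => //; exact: k_gt0.
split.
  (* Almost sure statements only combine over countably many tolerances, hence
     the restriction to those of the form 1 / (j + 1). *)
  have ae_near (j : nat) : {ae P, forall w,
      \forall n \near \oo, `|estimator n w - xF| <= 3 * j.+1%:R^-1}.
    have j0 : 0 < j.+1%:R^-1 :> R by rewrite invr_gt0.
    have [r r01 r_bound] := bad_small _ j0.
    have ae_good : {ae P, forall w, \forall n \near \oo, ~ bad j.+1%:R^-1 n w}.
      apply: ae_eventually_not r01 _ _.
        by move=> n; exact: measurable_few_exceedances.
      by apply: filterS r_bound => n [].
    have := ae_le_endpoint X_cdf F_endpoint j0.
    apply: filterS2 ae_good => w good le_xF; near=> n.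
    by apply: estimator_near => //; near: n; [exists 1%N|exact: good].
  apply: filterS (ae_foralln ae_near) => w near_xF.
  apply/cvgrPdist_le => e e0.
  have /ltr_add_invr[j je] : 0 < e / 3 by lra.
  apply: filterS (near_xF j) => n; rewrite distrC => /le_trans; apply.
  by move: je; rewrite add0r ltr_pdivlMr// mulrC => /ltW.
move=> eps eps0; pose e := eps / 3.
have e0 : 0 < e by rewrite /e; lra.
have [r /andP[r0 r1] r_bound] := bad_small _ e0.
apply: (@squeeze_cvge _ _ _ _ (cst 0%E) _ (fun n => (r ^+ n)%:E)).
- have [N0 [mN0 PN0 leN0]] := ae_le_endpoint X_cdf F_endpoint e0.
  near=> n.
  have n0 : (0 < n)%N by near: n; exists 1%N.
  have [kn bad_n] : (2 * k n <= n)%N /\ (P (bad e n) <= (r ^+ n)%:E)%E by near: n.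
  rewrite measure_ge0/=.
  have m_bad : measurable (bad e n) by exact: measurable_few_exceedances.
  have m_est : measurable_fun setT (estimator n).
    by apply: measurable_endpoint_estimator => //; exact: k_gt0.
  (* Outside the bad event and the null set N0, the error is at most
     3 * e = eps. *)
  apply: (@le_trans _ _ (P (bad e n `|` N0))).
    apply: le_measure; rewrite ?inE; last 1 first.
    + move=> w /= far; apply: contrapT => /not_orP[good nN0].
      have le_xF : forall i, X i w <= xF + e.
        by apply: contrapT => gt_xF; apply: nN0; apply: leN0.
      have := estimator_near e n w n0 le_xF good.
      by rewrite /e; lra.
    + have -> : [set w | eps < `|estimator n w - xF|] =
          (fun w => `|estimator n w - xF|) @^-1` `]eps, +oo[.
        by apply/seteqP; split => w /=; rewrite in_itv/= andbT.
      rewrite -[X in measurable X]setTI.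
      suff: measurable_fun setT (fun w => `|estimator n w - xF|).
        by apply => //; exact: measurable_itv.
      by apply: measurableT_comp => //; apply: measurable_funB.
    + exact: measurableU.
  apply: le_trans (measureU2 _ _ _) _ => //.
  rewrite -[leRHS]adde0; apply: leeD => //.
  by rewrite le_eqVlt; apply/orP; left; apply/eqP.
- exact: cvg_cst.
- apply: cvg_EFin; first exact: nearW.
  by apply: cvg_expr; rewrite ger0_norm.
Unshelve. all: by end_near. Qed.
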